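(* For every $c \in \mathbb{N}$ there exists a countable, metabelian, torsion-free, nilpotent group with the Magnus property that has nilpotency class precisely $c$.
   Context: $\mathbb{N} = \{1,2,3,\ldots\}$. A group $G$ has the Magnus property if, whenever $g,h \in G$ generate the same normal subgroup $\langle g\rangle^G = \langle h\rangle^G$ (normal closures), $g$ is conjugate in $G$ to $h$ or to $h^{-1}$. Metabelian means that the derived subgroup $[G,G]$ is abelian (in particular, abelian groups are metabelian). *)

(* Defs.v *)
From mathcomp Require Import all_boot.
From mathcomp Require Import boolp classical_sets functions cardinality.

Set Implicit Arguments.
Unset Strict Implicit.
Unset Printing Implicit Defensive.

Local Open Scope group_scope.
Local Open Scope classical_set_scope.

(* Groups are MathComp's [groupType], which need not be finite; their subgroups
   are represented as classical subsets [set G]. *)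

Section Subgroups.
Variable G : groupType.
Implicit Types (H K : set G) (g h x y : G).

Definition is_subgroup H : Prop :=
  H 1 /\ (forall x y, H x -> H y -> H (x / y)).

Definition is_normal_subgroup H : Prop :=
  is_subgroup H /\ (forall x y, H x -> H (x ^ y)).

(* [smallest C A] is the intersection of all [M] with [C M] and [A `<=` M]. *)
Definition generated (A : set G) : set G := smallest is_subgroup A.

Definition normal_closure g : set G := smallest is_normal_subgroup [set g].

Definition commutator_subgroup H K : set G :=
  generated [set [~ x, y] | x in H & y in K].

Definition conjugate g h : Prop := exists x, g ^ x = h.

End Subgroups.

Unset Implicit Arguments.

Definition derived_subgroup (G : groupType) : set G :=
  commutator_subgroup [set: G] [set: G].

Definition metabelian (G : groupType) : Prop :=
  forall x y : G, derived_subgroup G x -> derived_subgroup G y -> commute x y.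

Definition torsion_free (G : groupType) : Prop :=
  forall (x : G) (n : nat), (0 < n)%N -> x ^+ n = 1 -> x = 1.

Definition magnus_property (G : groupType) : Prop :=
  forall g h : G, normal_closure g = normal_closure h ->
    conjugate g h \/ conjugate g h^-1.

(* Indexed from 0: [lower_central G n] is the term gamma_(n+1), with
   gamma_1 = G and gamma_(n+1) = [gamma_n, G]. *)
Fixpoint lower_central (G : groupType) (n : nat) : set G :=
  if n is m.+1 then commutator_subgroup (lower_central G m) [set: G]
  else [set: G].

Definition nilpotent (G : groupType) : Prop :=
  exists n, lower_central G n = [set 1].

Definition has_nilpotency_class (G : groupType) (c : nat) : Prop :=
  lower_central G c = [set 1] /\
  (forall n, lower_central G n = [set 1] -> (c <= n)%N).

(* Main.v *)
Require Import Defs.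
From HB Require Import structures.
From mathcomp Require Import all_boot all_algebra.
From mathcomp Require Import ring.
From mathcomp Require Import boolp classical_sets functions cardinality.

(** The proof rests on a criterion: a torsion-free nilpotent group [G] in which,
    for every [g], the commutators [[~ g, x]] form a subgroup [L_g] has the
    Magnus property ([magnus_of_comm_sets]).  Indeed [L_g] is then normal, [g]
    is central modulo [L_g], and the conjugacy class of [g] is exactly the coset
    [g L_g].  If [g] and [h] have the same normal closure, then [h] lies in
    [g^z L_g] for some integer [z], and [g], which lies in the normal closure of
    [h], lies in [g^(zk) L_g] for some integer [k].  So [g^(1 - zk)] is a
    commutator [[~ g, w]].  If [1 - zk] were nonzero, iterating the commutator
    with [w] would only raise [g] to further nonzero powers, and nilpotency would
    make [g] a torsion element.  Hence [zk = 1], [z] is 1 or -1, and [h] lies in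
    the class of [g] or of its inverse.

    The groups come from a local ring [R] whose maximal ideal is generated by a
    nilpotent element [t].  On [R * R] put
    [(a, b) (a', b') = (a + (1 + t b) a', b + (1 + t b) b')]; this is the
    semidirect product of the additive group of [R] with an abelian group that
    acts through the units [1 + t b], hence it is metabelian.  Its commutators
    are
    [[~ (a, b), (a', b')] = (t (b a' - b' a) / ((1 + t b) (1 + t b')), 0)]
    ([commg_radE]).  Divisibility is a total preorder on [R], so the ideal
    generated by [a] and [b] is generated by one of them, say [s], and the
    commutators of [(a, b)] fill the whole subgroup [t s R * 0]
    ([comm_set_rad_chain]): the criterion applies.  The [k]-fold commutators
    generate [t^k R * 0], so the nilpotency class is the nilpotency index of [t].
    It remains to take for [R] the rational polynomials modulo the [c]-th power
    of the variable, and for [t] the image of the variable; rational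
    coefficients keep [R] countable and make the group torsion-free. *)

Set Implicit Arguments.
Unset Strict Implicit.
Unset Printing Implicit Defensive.

(** * Integer powers in a group *)

Section IntegerPowers.
Import GRing.Theory Num.Theory.
Local Open Scope group_scope.
Variable G : groupType.
Implicit Types (g x : G) (y z : int).

Definition expgz g z : G :=
  match z with Posz n => g ^+ n | Negz n => g ^- n.+1 end.

(** Writing an integer as a difference of naturals reduces the laws of
    exponents to those of natural powers, without a case analysis on signs. *)
Lemma expgz_sub_nat g (m n : nat) :
  expgz g (m%:Z - n%:Z)%R = g ^+ m / g ^+ n.
Proof.
case: (leqP n m) => [le_nm|lt_mn].
  by rewrite subzn //= expgnFr.
have -> : (m%:Z - n%:Z)%R = Negz (n - m).-1.
  by rewrite -opprB subzn ?(ltnW lt_mn) // NegzE prednK // subn_gt0.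
by rewrite /= prednK ?subn_gt0 // expgnFr ?(ltnW lt_mn) // invgF.
Qed.

Lemma int_sub_nat z : exists m n : nat, z = (m%:Z - n%:Z)%R.
Proof.
case: z => n; first by exists n, 0; rewrite subr0.
by exists 0, n.+1; rewrite sub0r NegzE.
Qed.

Lemma expgzB g y z : expgz g (y - z)%R = expgz g y / expgz g z.
Proof.
have [a [b ->]] := int_sub_nat y; have [c [d ->]] := int_sub_nat z.
have -> : (a%:Z - b%:Z - (c%:Z - d%:Z))%R = ((a + d)%:Z - (b + c)%:Z)%R.
  by rewrite !PoszD; ring.
rewrite !expgz_sub_nat invgF [b + c]addnC !expgnDr invgM !mulgA.
have C i j : commute (g ^+ i) (g ^- j) by exact/commuteV/commuteX2.
by congr (_ / _); rewrite -!mulgA; congr (_ * _); exact: C.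
Qed.

Lemma expgzN g z : expgz g (- z)%R = (expgz g z)^-1.
Proof. by rewrite -sub0r expgzB mul1g. Qed.

Lemma expgzD g y z : expgz g (y + z)%R = expgz g y * expgz g z.
Proof. by rewrite -[z in LHS]opprK expgzB expgzN invgK. Qed.

Lemma expgzJ g z x : expgz g z ^ x = expgz (g ^ x) z.
Proof. by case: z => n /=; rewrite ?conjVg conjXg. Qed.

Lemma expgzM g y z : expgz g (y * z)%R = expgz (expgz g y) z.
Proof.
have pos (n : nat) : expgz g (y * n%:Z)%R = expgz g y ^+ n.
  elim: n => [|n IH]; first by rewrite mulr0.
  by rewrite -addn1 PoszD mulrDr mulr1 expgzD IH addn1 expgSr.
case: z => n; first exact: pos.
by rewrite NegzE mulrN !expgzN (pos n.+1).
Qed.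

Lemma torsion_free_expgz g z :
  torsion_free G -> expgz g z = 1 -> z != 0%R -> g = 1.
Proof.
move=> tf; case: z => [[|n]|n] //= e _; first exact: (tf _ n.+1).
by apply: (tf _ n.+1) => //; rewrite -[LHS]invgK e invg1.
Qed.

End IntegerPowers.

(** * A criterion for the Magnus property *)

Section CommutatorSubgroups.
Import GRing.Theory Num.Theory.
Local Open Scope group_scope.
Local Open Scope classical_set_scope.
Variable G : groupType.
Implicit Types (g h x y : G) (L : set G).

Lemma is_subgroupV L x : is_subgroup L -> L x -> L x^-1.
Proof. by case=> L1 LF Lx; rewrite -div1g; exact: LF. Qed.

Lemma is_subgroupM L x y : is_subgroup L -> L x -> L y -> L (x * y).
Proof.
by move=> sL Lx Ly; rewrite -[y]invgK; apply: sL.2 => //; exact: is_subgroupV.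
Qed.

Lemma is_subgroup_expgz L x z : is_subgroup L -> L x -> L (expgz x z).
Proof.
move=> sL Lx.
have pos n : L (x ^+ n).
  by elim: n => [|n IH]; [exact: sL.1 | rewrite expgS; exact: is_subgroupM].
by case: z => n /=; [exact: pos | apply: is_subgroupV; [exact: sL|exact: pos]].
Qed.

Lemma commMg x y w : [~ x * y, w] = [~ x, w] ^ y * [~ y, w].
Proof. by rewrite !commgEl conjMg invgM !conjgE -!mulgA !mulVKg. Qed.

Lemma commgM x y w : [~ x, y * w] = [~ x, w] * [~ x, y] ^ w.
Proof. by rewrite !commgEl conjMg conjVg conjgM -mulgA mulVKg. Qed.

(** By [commgM], a conjugate of [[~ g, y]] is a quotient of two commutators of
    [g]. *)
Lemma comm_set_normal g :
  is_subgroup (range (commg g)) -> is_normal_subgroup (range (commg g)).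
Proof.
move=> sL; split=> // _ w [y _ <-].
have -> : [~ g, y] ^ w = [~ g, w]^-1 * [~ g, y * w] by rewrite commgM mulKg.
by apply: is_subgroupM; [|apply: is_subgroupV; [|exists w]|exists (y * w)].
Qed.

(** This set is the preimage of the centre of the quotient by [L]. *)
Lemma central_mod_subgroup L :
  is_normal_subgroup L -> is_subgroup [set x | forall w, L [~ x, w]].
Proof.
move=> [sL nL]; split=> [w|x y Lx Ly w /=]; first by rewrite comm1g; exact: sL.1.
rewrite commMg; apply: is_subgroupM => //; first exact: nL.
have -> : [~ y^-1, w] = ([~ y, w] ^ y^-1)^-1.
  by apply/esym/mulg1_eq; rewrite -commMg mulgV comm1g.
by apply: is_subgroupV => //; exact: nL.
Qed.

(** Modulo [L] the element [h] is the central element [g ^ z], so its normal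
    closure reduces to the powers of [g ^ z].  It is used with [h = g], and
    again with a second generator of the normal closure of [g]. *)
Lemma normal_closure_mod L g h z l :
    is_normal_subgroup L -> (forall w, L [~ g, w]) ->
    L l -> h = expgz g z * l ->
  forall x, normal_closure h x ->
    exists k l', L l' /\ x = expgz g (z * k)%R * l'.
Proof.
move=> nLn gL Ll ->; have [sL nL] := nLn.
have cL k w : L [~ expgz g k, w].
  exact: (is_subgroup_expgz k (central_mod_subgroup nLn) gL).
apply: smallest_sub; last first.
  by move=> _ ->; exists 1%R, l; rewrite mulr1.
split; first split.
- by exists 0%R, 1; rewrite mulr0 mulg1; split=> //; exact: sL.1.
- move=> _ _ [k [a [La ->]]] [m [b [Lb ->]]].
  exists (k - m)%R, ((a / b) ^ (expgz g (z * m))^-1); split.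
    by apply: nL; exact: sL.2.
  by rewrite mulrBr expgzB invgM conjgE invgK !mulgA mulgVK.
- move=> _ w [k [a [La ->]]].
  exists k, ([~ expgz g (z * k), w] * a ^ w); split.
    by apply: is_subgroupM => //; exact: nL.
  by rewrite conjMg commgEl -[in RHS]mulgA mulVKg.
Qed.

(** Conjugation by [w] raises [g] to the power [1 + k], so commutation with [w]
    raises every power of [g] to the power [k]; hence [g ^ (k ^ i)] reaches the
    [i]-th term of the lower central series. *)
Lemma nilpotent_comm_power_trivial g w k :
  nilpotent G -> torsion_free G -> [~ g, w] = expgz g k -> k != 0%R -> g = 1.
Proof.
move=> [c nil] tf e k0.
have gw : g ^ w = expgz g (1 + k)%R by rewrite expgzD -e commgEl mulVKg.
have mem i : lower_central G i (expgz g (k ^+ i)%R).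
  elim: i => [//|i IH].
  have -> : expgz g (k ^+ i.+1)%R = [~ expgz g (k ^+ i)%R, w].
    rewrite commgEl expgzJ gw -expgzM mulrDl mul1r expgzD mulKg.
    by rewrite exprS.
  by apply: sub_gen_smallest; exists (expgz g (k ^+ i)%R) => //; exists w.
have := mem c; rewrite nil => /torsion_free_expgz; apply=> //.
exact: expf_neq0.
Qed.

(** The hypothesis on commutators says that each conjugacy class is a coset of a
    normal subgroup, so conjugacy can be decided modulo that subgroup. *)
Lemma magnus_of_comm_sets :
    nilpotent G -> torsion_free G ->
    (forall g : G, is_subgroup (range (commg g))) ->
  magnus_property G.
Proof.
move=> nil tf sub g h gh.
have nL := comm_set_normal (sub g); have [sL _] := nL.
have gL w : range (commg g) [~ g, w] by exists w.
have [z [l [Ll hE]]] : exists z l,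
    range (commg g) l /\ h = expgz g (1 * z)%R * l.
  apply: (normal_closure_mod (h := g) nL gL sL.1); first by rewrite mulg1.
  by rewrite gh; exact: sub_gen_smallest.
rewrite mul1r in hE.
have [k [l' [Ll' gE]]] : exists k l',
    range (commg g) l' /\ g = expgz g (z * k)%R * l'.
  apply: (normal_closure_mod nL gL Ll hE).
  by rewrite -gh; exact: sub_gen_smallest.
have [g1|gN1] := eqVneq g 1.
  left; exists 1; rewrite conjg1 hE; case: Ll => w _ <-.
  by rewrite g1 comm1g mulg1; case: (z) => n /=; rewrite expg1n ?invg1.
(* Otherwise a nontrivial power of g would be a commutator of g. *)
have zk1 : (z * k = 1)%R.
  have [w _ wE] := Ll'; apply/eqP; rewrite eq_sym -subr_eq0.
  apply: contraNT gN1 => zkN1; apply/eqP.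
  apply: (nilpotent_comm_power_trivial (w := w) nil tf _ zkN1).
  apply: (mulgI (expgz g (z * k)%R)).
  by rewrite wE -gE -expgzD addrCA subrr addr0.
have : z \is a GRing.unit by apply/unitrP; exists k; rewrite mulrC zk1.
rewrite qualifE /= /intUnitRing.unitz => /orP[] /eqP zE; [left|right].
  by case: Ll => w _ wE; exists w; rewrite hE zE -wE commgEl mulVKg.
have [w _ wE] : range (commg g) ((l^-1) ^ g).
  by apply: nL.2; exact: is_subgroupV.
exists w; rewrite hE zE invgM.
by rewrite -(mulVKg g (g ^ w)) -commgEl wE conjgE mulVKg invgK.
Qed.
End CommutatorSubgroups.

(** * Affine groups over a ring with a radical element *)

Section RadicalAffineGroup.
Import GRing.Theory.
Local Open Scope ring_scope.

(** The second component is composed by [b + b' + t b b'], which makes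
    [1 + t b] multiplicative in [b]; recording [b] rather than this unit avoids
    a subtype, at the price that [b] acts trivially when [t * b = 0].  The condition on [t]
    puts it in the Jacobson radical; the type carries its proof because the
    group inverse needs it. *)
Definition radical_affine (R : comUnitRingType) (t : R)
  (t_rad : forall u r, u \is a GRing.unit -> u + t * r \is a GRing.unit)
  : Type := (R * R)%type.

Variables (R : comUnitRingType) (t : R).
Hypothesis t_rad :
  forall u r, u \is a GRing.unit -> u + t * r \is a GRing.unit.
Local Notation G := (radical_affine t_rad).
Implicit Types (v w : G) (a b r : R).

Let act b : R := 1 + t * b.

Let act_unit b : act b \is a GRing.unit.
Proof. exact/t_rad/unitr1. Qed.

Let one : G := (0, 0).
Let mul v w : G := (v.1 + act v.2 * w.1, v.2 + act v.2 * w.2).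
Let inv v : G := (- (v.1 / act v.2), - (v.2 / act v.2)).

Let opA : associative mul.
Proof.
by move=> [a b] [a' b'] [a2 b2]; rewrite /mul /act /=; congr pair; ring.
Qed.

Let op1l : left_id one mul.
Proof. by move=> [a b]; rewrite /mul /act /=; congr pair; ring. Qed.

Let op1r : right_id one mul.
Proof. by move=> [a b]; rewrite /mul /act /=; congr pair; ring. Qed.

Let opVr : right_inverse one inv mul.
Proof.
move=> [a b]; rewrite /mul /inv /=.
by rewrite !mulrN ![act b * _]mulrC !divrK ?act_unit // !subrr.
Qed.

Let act_inv b : act (- (b / act b)) = (act b)^-1.
Proof.
apply: (mulIr (act_unit b)); rewrite mulVr ?act_unit // {1}/act mulrDl mul1r.
by rewrite mulrN mulNr mulrA divrK ?act_unit // /act addrK.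
Qed.

Let opVl : left_inverse one inv mul.
Proof.
by move=> [a b]; rewrite /mul /inv /= act_inv !(mulrC _^-1) !addNr.
Qed.

HB.instance Definition _ := Choice.on G.
HB.instance Definition _ := isGroup.Build G opA op1l op1r opVl opVr.

Lemma mul_radE v w :
  (v * w)%g = (v.1 + (1 + t * v.2) * w.1, v.2 + (1 + t * v.2) * w.2) :> G.
Proof. by []. Qed.

Lemma commg_radE v w :
  [~ v, w]%g = (t * (v.2 * w.1 - w.2 * v.1)
                  / ((1 + t * v.2) * (1 + t * w.2)), 0) :> G.
Proof.
have Uv := act_unit v.2; have Uw := act_unit w.2.
have U : (1 + t * v.2) * (1 + t * w.2) \is a GRing.unit.
  by rewrite unitrM Uv.
apply: (mulgI (w * v)%g); rewrite -commgC !mul_radE /=; congr pair; last by ring.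
have -> : 1 + t * (w.2 + (1 + t * w.2) * v.2) = (1 + t * v.2) * (1 + t * w.2).
  by ring.
by rewrite [_ * (_ / _)]mulrC divrK //; ring.
Qed.

(** The principal ideal [s R], placed in the abelian normal factor. *)
Definition fst_ideal s : set G := range (fun r => (s * r, 0) : G).

Lemma fst_ideal_subgroup s : is_subgroup (fst_ideal s).
Proof.
split=> [|_ _ [a _ <-] [b _ <-]]; first by exists 0; rewrite ?mulr0.
exists (a - b) => //; apply: (mulIg ((s * b, 0) : G)).
by rewrite mulgVK mul_radE /=; congr pair; ring.
Qed.

Lemma fst_ideal_commute s v w : fst_ideal s v -> fst_ideal s w -> commute v w.
Proof.
by move=> [a _ <-] [b _ <-]; rewrite /commute !mul_radE /=; congr pair; ring.
Qed.

Lemma commg_rad_fst a w :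
  [~ (a, 0) : G, w]%g = (t * a * (- (w.2 / (1 + t * w.2))), 0) :> G.
Proof. by rewrite commg_radE /= mulr0 addr0 mul1r; congr pair; ring. Qed.

(** The generator [s] is the component of [v] that divides the other one; the
    second argument of the commutator then only has to vary in the other
    component. *)
Lemma comm_set_rad_chain :
    (forall a b, (exists d, a = b * d) \/ (exists d, b = a * d)) ->
  forall v, exists s, range (commg v) = fst_ideal (t * s).
Proof.
move=> chain [a b].
case: (chain a b) => -[d ->]; [exists b|exists a]; apply/seteqP; split.
- move=> _ [w _ <-].
  exists ((w.1 - w.2 * d) / ((1 + t * b) * (1 + t * w.2))) => //.
  by rewrite commg_radE /=; congr pair; ring.
- move=> _ [r _ <-]; exists ((r * act b, 0) : G) => //.
  rewrite commg_radE /= mulr0 addr0 mulr1 mul0r subr0; congr pair.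
  by rewrite !mulrA mulrK ?act_unit.
- move=> _ [w _ <-].
  exists ((d * w.1 - w.2) / ((1 + t * (a * d)) * (1 + t * w.2))) => //.
  by rewrite commg_radE /=; congr pair; ring.
- move=> _ [r _ <-]; have Ue := act_unit (a * d); set e := act (a * d) in Ue *.
  (* This second component b' makes 1 + t b' the inverse of 1 + t r e, and then
     - b' / (1 + t b') is r e. *)
  exists ((0, - (r * e / act (r * e))) : G) => //.
  rewrite commg_radE /= -/(act _) -/e -/(act _) act_inv; congr pair.
  rewrite mulr0 sub0r mulNr opprK invrM ?unitrV ?act_unit // invrK.
  rewrite -[RHS]mulr1 -(divrr Ue) -[RHS]mulr1 -(divrr (act_unit (r * e))).
  by ring.
Qed.

(** The [n]-th power multiplies both components by the sum of the first [n]
    powers of [1 + t * v.2], which is [n] modulo [t]. *)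
Lemma expg_rad v n :
  exists r, (v ^+ n)%g = ((n%:R + t * r) * v.1, (n%:R + t * r) * v.2) :> G.
Proof.
elim: n => [|n [r IH]].
  by exists 0; rewrite mulr0 addr0 !mul0r.
exists (r + v.2 * (n%:R + t * r)).
by rewrite expgS IH mul_radE /= -natr1; congr pair; ring.
Qed.

Lemma torsion_free_rad :
  (forall n, n.+1%:R \is a @GRing.unit R) -> torsion_free G.
Proof.
move=> char0 v [//|n] _; have [r ->] := expg_rad v n.+1.
have U := t_rad r (char0 n); case: v => a b /= [].
by move=> /(canRL (mulKr U)) -> /(canRL (mulKr U)) ->; rewrite mulr0.
Qed.

Lemma metabelian_rad : metabelian G.
Proof.
have sub : (derived_subgroup G `<=` fst_ideal 1)%classic.
  apply: smallest_sub; first exact: fst_ideal_subgroup.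
  move=> _ [v _ [w _ <-]]; rewrite commg_radE -[X in (X, _)]mul1r.
  by eexists.
by move=> v w /sub v1 /sub w1; exact: fst_ideal_commute v1 w1.
Qed.

Lemma lower_central_rad k : lower_central G k.+1 = fst_ideal (t ^+ k.+1).
Proof.
apply/seteqP; split.
  elim: k => [|k IH]; apply: smallest_sub; try exact: fst_ideal_subgroup.
    move=> _ [v _ [w _ <-]]; rewrite commg_radE expr1 -mulrA.
    by eexists.
  move=> _ [v /IH [a _ <-] [w _ <-]]; rewrite commg_rad_fst mulrA -exprS -mulrA.
  by eexists.
move=> _ [r _ <-]; elim: k.+1 r => [//|m IH] r.
(* The factor 1 - t cancels the denominator contributed by (0, -1). *)
apply: sub_gen_smallest; exists ((t ^+ m * (r * (1 - t)), 0) : G);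
  first exact: IH.
exists ((0, -1) : G) => //; rewrite commg_rad_fst /=.
have U : 1 - t \is a GRing.unit by rewrite -[t]mulr1 -mulrN; exact: act_unit.
have -> : 1 + t * -1 = 1 - t by ring.
by rewrite mulNr opprK mul1r exprS -!mulrA mulrV // mulr1.
Qed.

Lemma nilpotency_class_rad c : (0 < c)%N ->
    t ^+ c = 0 -> (forall k, t ^+ k = 0 -> (c <= k)%N) ->
  has_nilpotency_class G c.
Proof.
move=> c0 tc tmin; split.
  case: c c0 tc {tmin} => // c _ tc; rewrite lower_central_rad tc.
  apply/seteqP; split=> [_ [r _ <-]|_ ->]; first by rewrite mul0r.
  by exists 0; rewrite // mul0r.
move=> k; case: k => [|k] /seteqP[] sub _.
  have /(congr1 snd) /= := sub ((0, 1) : G) I.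
  by move=> /eqP; rewrite oner_eq0.
apply: tmin; rewrite lower_central_rad in sub.
have /(congr1 fst) := sub ((t ^+ k.+1 * 1, 0) : G) (ex_intro2 _ _ 1 I erefl).
by rewrite mulr1.
Qed.

End RadicalAffineGroup.

(** * Local rings with a nilpotent uniformizer *)

Section NilpotentUniformizer.
Import GRing.Theory.
Local Open Scope ring_scope.
Variables (R : comUnitRingType) (t : R) (c : nat).
Hypothesis t_nil : t ^+ c = 0.
Hypothesis t_local : forall a : R, a \is a GRing.unit \/ exists b, a = t * b.

Lemma mult_uniformizer_nonunit (b : R) : t * b \isn't a GRing.unit.
Proof.
rewrite unitrM negb_and; apply/orP; left; apply/negP => Ut.
by have := unitrX c Ut; rewrite t_nil unitr0.
Qed.

(** If [u + t r] were a multiple of [t], then so would be the unit [u]. *)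
Lemma uniformizer_radical (u r : R) :
  u \is a GRing.unit -> u + t * r \is a GRing.unit.
Proof.
move=> Uu; case: (t_local (u + t * r)) => // -[b e].
have uE : u = t * (b - r) by rewrite mulrBr -e addrK.
by have := mult_uniformizer_nonunit (b - r); rewrite -uE Uu.
Qed.

(** Splitting off factors [t] stops at a unit, or reaches [t ^+ c = 0]. *)
Lemma uniformizer_factor (a : R) :
  a = 0 \/ exists k u, u \is a GRing.unit /\ a = t ^+ k * u.
Proof.
suff: forall m, (exists b, a = t ^+ m * b) \/
    exists k u, u \is a GRing.unit /\ a = t ^+ k * u.
  by case/(_ c) => [[b ->]|]; [left; rewrite t_nil mul0r | right].
elim=> [|m [[b aE]|]]; [by left; exists a; rewrite mul1r | | by right].
case: (t_local b) => [Ub|[b' bE]]; first by right; exists m, b.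
by left; exists b'; rewrite aE bE exprSr mulrA.
Qed.

Lemma uniformizer_chain (a b : R) :
  (exists d, a = b * d) \/ (exists d, b = a * d).
Proof.
have dvd k m u v : (k <= m)%N -> u \is a GRing.unit ->
    exists d, t ^+ m * v = t ^+ k * u * d.
  move=> le_km Uu; exists (t ^+ (m - k) * v / u).
  by rewrite -{1}(subnKC le_km) exprD -[LHS]mulr1 -(divrr Uu); ring.
case: (uniformizer_factor a) => [->|[k [u [Uu ->]]]].
  by left; exists 0; rewrite mulr0.
case: (uniformizer_factor b) => [->|[m [v [Uv ->]]]].
  by right; exists 0; rewrite mulr0.
by case: (leqP k m) => [|/ltnW] le; [right|left]; exact: dvd.
Qed.
End NilpotentUniformizer.

(** * Truncated polynomials *)

Section TruncatedPolynomials.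
Import GRing.Theory.
Local Open Scope ring_scope.
Variables (F : fieldType) (n : nat).
Local Notation h := ('X^(n.+1) : {poly F}).
Local Notation t := ('qX : {poly %/ h}).

Lemma truncXE k : t ^+ k = in_qpoly h 'X^k.
Proof. by rewrite rmorphXn. Qed.

Lemma truncX_nilpotent : t ^+ n.+1 = 0.
Proof.
rewrite truncXE; apply: val_inj => /=.
by rewrite mk_monic_Xn Pdiv.RingMonic.rmodpp ?monicXn.
Qed.

Lemma truncX_min k : t ^+ k = 0 -> (n < k)%N.
Proof.
move=> tk; rewrite ltnNge; apply/negP => le_kn.
have /(congr1 val) /eqP := tk.
rewrite truncXE /= Pdiv.Ring.rmodp_small ?mk_monic_Xn ?size_polyXn //.
by rewrite -size_poly_eq0 size_polyXn.
Qed.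

(** A polynomial with nonzero constant term is coprime to any power of the
    variable. *)
Lemma trunc_unit_or_multX (a : {poly %/ h}) :
  a \is a GRing.unit \/ exists b, a = t * b.
Proof.
have aE : a = in_qpoly h (val a).
  by apply: val_inj; rewrite /= Pdiv.Ring.rmodp_small ?size_mk_monic.
have [a0|a0] := boolP (root (val a) 0); [right|left].
  have [q qE] := factor_theorem _ _ a0.
  exists (in_qpoly h q); rewrite aE qE rmorphM /= mulrC; congr (_ * _).
  by rewrite subr0.
have cop (p : {poly F}) : ~~ root p 0 -> coprimep (mk_monic h) p.
  by rewrite mk_monic_Xn -coprimep_XsubC subr0 coprimep_sym => /coprimep_expl.
exact: cop.
Qed.

Lemma trunc_natr_unit m : m%:R \is a @GRing.unit F ->
  m%:R \is a @GRing.unit {poly %/ h}.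
Proof. by move=> Um; rewrite -(rmorph_nat (qpolyC h)) rmorph_unit. Qed.
End TruncatedPolynomials.

(** * Existence in every nilpotency class *)

Unset Implicit Arguments.

Theorem theorem1p3 (c : nat) (hc : (0 < c)%N) :
  exists G : groupType,
    countable [set: G]%classic /\ metabelian G /\ torsion_free G /\
    nilpotent G /\ magnus_property G /\ has_nilpotency_class G c.
Proof.
case: c hc => // n _.
pose R := {poly %/ ('X^(n.+1) : {poly rat})}.
have tnil := truncX_nilpotent rat n.
have tlocal := @trunc_unit_or_multX rat n.
pose rad := uniformizer_radical tnil tlocal.
have class_c := nilpotency_class_rad rad (ltn0Sn n) tnil (@truncX_min rat n).
have tf : torsion_free (radical_affine rad).
  apply: torsion_free_rad => m; apply: trunc_natr_unit.
  by rewrite GRing.unitfE Num.Theory.pnatr_eq0.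
have nil : nilpotent (radical_affine rad) by exists n.+1; exact: class_c.1.
exists (radical_affine rad); split; last split; last split => //.
- exact: (@countableP (R * R)%type).
- exact: metabelian_rad.
- split=> //; split=> //; apply: magnus_of_comm_sets => // g.
  have [s ->] := comm_set_rad_chain (uniformizer_chain tnil tlocal) g.
  exact: fst_ideal_subgroup.
Qed.
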